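(* Let $k,\ell,n$ be positive integers, let $\sigma\in S_n$ and let $(P,Q)$ be the pair of standard Young tableaux corresponding to $\sigma$ under the RSK correspondence. Then $\sigma$ is $(k,\ell)$-right-crucial if and only if all of the following hold: (1) the number of columns in $P$ (and $Q$) is $k-1$; (2) the number of rows in $P$ (and $Q$) is $\ell-1$; (3) $P$ contains an increasing sequence of elements $p_{1,k-1}<p_{2,j_2}<\cdots<p_{\ell-1,j_{\ell-1}}$ for some column indices $j_2,\ldots,j_{\ell-1}$.
   Context: $S_n$ is the set of permutations $\sigma=\sigma_1\cdots\sigma_n$ of $\{1,\ldots,n\}$ in one-line notation. $i_m=12\cdots m$ and $d_m=m(m-1)\cdots 1$; a permutation contains $i_m$ (resp. $d_m$) if it has an increasing (resp. decreasing) subsequence of length $m$, and avoids it otherwise. The extensions of $\sigma\in S_n$ to the right are the $n+1$ permutations $e_i(\sigma_1)\cdots e_i(\sigma_n)\,i\in S_{n+1}$, $1\le i\le n+1$, where $e_i(x)=x$ if $x<i$ and $e_i(x)=x+1$ if $x\ge i$. A permutation is $(k,\ell)$-right-crucial (also called $(k,\ell)$-crucial) if it avoids $i_k$ and $d_\ell$ but each of its extensions to the right contains $i_k$ or $d_\ell$. RSK: $P$ is the insertion tableau obtained by row-inserting $\sigma_1,\ldots,\sigma_n$ successively into the empty tableau, and $Q$ is the recording tableau. $p_{i,j}$ denotes the entry of $P$ in row $i$ (from the top) and column $j$ (from the left); rows and columns of a standard Young tableau are increasing (left to right, top to bottom). *)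

(* Defs.v *)
From mathcomp Require Import all_boot all_fingroup.

Set Implicit Arguments.
Unset Strict Implicit.
Unset Printing Implicit Defensive.

(* 'S_n permutes {0, ..., n-1}; the one-line word is shifted to {1, ..., n}. *)
Definition one_line n (s : 'S_n) : seq nat :=
  [seq (s i).+1 | i <- enum 'I_n].

Definition contains_incr m n (s : 'S_n) : Prop :=
  exists t : seq nat, [/\ subseq t (one_line s), size t = m & sorted ltn t].

Definition contains_decr m n (s : 'S_n) : Prop :=
  exists t : seq nat, [/\ subseq t (one_line s), size t = m & sorted gtn t].

(* lift_perm applies the 0-based shift x |-> x + (i <= x) to the old values and
   puts i in last position; see one_line_extension for the 1-based word. *)
Definition right_extension n (s : 'S_n) (i : 'I_n.+1) : 'S_n.+1 :=
  lift_perm ord_max i s.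

Definition shift_from (i x : nat) : nat := if x < i then x else x.+1.

Lemma one_line_extension n (s : 'S_n) (i : 'I_n.+1) :
  one_line (right_extension s i) =
    rcons [seq shift_from i.+1 x | x <- one_line s] i.+1.
Proof.
rewrite /one_line /right_extension enum_ordSr map_rcons lift_perm_id.
congr rcons; rewrite -!map_comp; apply: eq_map => j /=.
have -> : widen_ord (leqnSn n) j = lift ord_max j.
  by apply: val_inj; rewrite /= /bump leqNgt ltn_ord.
rewrite lift_perm_lift /= /bump /shift_from ltnS.
by case: leqP.
Qed.

Definition right_crucial k l n (s : 'S_n) : Prop :=
  [/\ ~ contains_incr k s,
      ~ contains_decr l s
    & forall i : 'I_n.+1,
        contains_incr k (right_extension s i) \/
        contains_decr l (right_extension s i)].

(* A tableau is the list of its rows, from top to bottom. *)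
Definition tableau := seq (seq nat).

(* Returns the new tableau and the 0-based index of the row that gained a
   cell: x replaces the leftmost entry y > x of the top row, and y is inserted
   into the rows below; if there is no such y, x is appended to the top row. *)
Fixpoint row_insert (P : tableau) (x : nat) : tableau * nat :=
  if P is r :: P' then
    let c := find (fun y => x < y) r in
    if c < size r then
      let: (P'', a) := row_insert P' (nth 0 r c) in (set_nth 0 r c x :: P'', a.+1)
    else (rcons r x :: P', 0)
  else ([:: [:: x]], 0).

Definition add_cell (Q : tableau) (a t : nat) : tableau :=
  set_nth [::] Q a (rcons (nth [::] Q a) t).

(* w_t is the t-th letter of the word, with t starting at 1. *)
Definition RSK_step (PQ : tableau * tableau) (tw : nat * nat) :
    tableau * tableau :=
  let: (t, w_t) := tw in
  let: (P', a) := row_insert PQ.1 w_t in (P', add_cell PQ.2 a t).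

Definition RSK n (s : 'S_n) : tableau * tableau :=
  foldl RSK_step ([::], [::]) (zip (iota 1 n) (one_line s)).

Definition nb_rows (T : tableau) : nat := size T.

(* Row lengths of a Young tableau weakly decrease, so the top row meets every
   column. *)
Definition nb_cols (T : tableau) : nat := size (head [::] T).

(* Rows and columns are numbered from 1. *)
Definition is_cell (T : tableau) (i j : nat) : bool :=
  [&& 0 < i <= size T & 0 < j <= size (nth [::] T i.-1)].

Definition entry (T : tableau) (i j : nat) : nat :=
  nth 0 (nth [::] T i.-1) j.-1.

(* p_{1,c} < p_{2,j_2} < ... < p_{r,j_r}, with j_1 = c. *)
Definition has_chain_from (P : tableau) (r c : nat) : Prop :=
  exists j : nat -> nat,
    [/\ j 1 = c,
        forall i, 0 < i <= r -> is_cell P i (j i)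
      & forall i, 0 < i < r -> entry P i (j i) < entry P i.+1 (j i.+1)].

(* Main.v *)
Require Import Defs.
From mathcomp Require Import all_boot all_fingroup.
From mathcomp Require Import zify.

(** A right extension puts a new last letter c below the letters that are at
    least c.  So it creates a longer increasing subsequence exactly from an
    increasing subsequence with values below c, and a longer decreasing one
    exactly from a decreasing subsequence with values at least c.  Hence sigma
    is crucial iff it has neither i_k nor d_l and, for each c between 1 and
    n+1, it has either k-1 increasing letters below c or l-1 decreasing letters
    not below c ([right_crucialE]).

    These conditions all have the form [has_mono R p m w]: there is an
    R-monotone subsequence of length m with values in p, where p is convex
    (an interval of values).  Knuth moves preserve them ([knuth_has_incr],
    [knuth_has_decr]): a move swaps two letters x and z next to a letter y of
    intermediate value, so y can replace x or z in a monotone subsequence that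
    the swap breaks, and y is in p as soon as x and z are.  As a word is Knuth
    equivalent to the row reading word of its insertion tableau
    ([RSK_correct]), the word may be replaced by that reading word.

    In the reading word of P, where the rows are read from bottom to top, the
    longest increasing subsequence with values below b has the length of the
    part of the top row that is below b ([incr_reading]), and a decreasing
    subsequence takes at most one entry from each row
    ([decr_reading_transversal]).  The extreme choices c = n+1 and c = 1 then
    force k-1 columns and l-1 rows.  With these sizes fixed, the increasing
    alternative holds exactly for c > p_{1,k-1}, so the decreasing one is
    needed for all c <= p_{1,k-1}, and c = p_{1,k-1} is the strongest case: it
    asks for one entry per row, increasing downwards and bounded below by
    p_{1,k-1}.  Since p_{1,k-1} is the largest entry of the first row, this is
    the chain of the statement ([has_chainE]). *)

Set Implicit Arguments.
Unset Strict Implicit.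
Unset Printing Implicit Defensive.

(** * Monotone subsequences with restricted values *)

Definition has_mono (R : rel nat) (p : pred nat) (m : nat) (w : seq nat) :=
  exists t, [/\ subseq t w, size t = m, sorted R t & all p t].

Lemma subseq_split (T : eqType) (t a b : seq T) :
  subseq t (a ++ b) ->
  exists t1 t2, [/\ t = t1 ++ t2, subseq t1 a & subseq t2 b].
Proof.
case/subseqP=> m sz_m ->.
exists (mask (take (size a) m) a), (mask (drop (size a) m) b).
rewrite -{1}(cat_take_drop (size a) m) mask_cat ?mask_subseq //.
by rewrite size_takel // sz_m size_cat leq_addr.
Qed.

Lemma gtn_trans : transitive gtn.
Proof. by move=> y x z /= yx /ltn_trans; apply. Qed.

Lemma has_mono_le R p m m' w : m <= m' -> has_mono R p m' w -> has_mono R p m w.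
Proof.
move=> le_mm [t [sub_t sz_t sort_t p_t]]; exists (take m t); split.
- exact: subseq_trans (take_subseq _ _) sub_t.
- by rewrite size_takel // sz_t.
- exact: take_sorted.
- by move: p_t; rewrite -{1}(cat_take_drop m t) all_cat => /andP[].
Qed.

Lemma sub_has_mono R (p q : pred nat) m w :
  subpred p q -> has_mono R p m w -> has_mono R q m w.
Proof.
by move=> pq [t [? ? ? p_t]]; exists t; split=> //; apply: sub_all p_t.
Qed.

(** A monotone subsequence of [rcons (map f w) c] either avoids c or is a
    shorter one followed by c. *)
Lemma has_mono_rcons (R : rel nat) (p : pred nat) (f : nat -> nat) c m w :
    transitive R -> (forall x y, R (f x) (f y) = R x y) ->
    (forall x, R (f x) c = p x) ->
  has_mono R predT m.+1 (rcons (map f w) c) <->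
  has_mono R predT m.+1 w \/ has_mono R p m w.
Proof.
move=> R_tr fR fRc.
have all_c t : all (R^~ c) (map f t) = all p t.
  by rewrite all_map; apply: eq_all.
split=> [[t [sub_t sz_t sort_t _]]|].
  move: sub_t; rewrite -cats1 => /subseq_split[t1 [t2 [def_t sub1 sub2]]].
  case/subseqP: sub1 => b _; rewrite -map_mask; set s := mask b w => def_t1.
  have sub_s : subseq s w by exact: mask_subseq.
  have fRs : sorted R (map f s) = sorted R s.
    by rewrite sorted_map; apply: eq_sorted => x y /=.
  case/subseqP: sub2 def_t => [[|[] []]] //= _ -> def_t.
    right; exists s; move: sort_t sz_t; rewrite def_t def_t1.
    rewrite cats1 !(sorted_pairwise R_tr) pairwise_rcons size_rcons.
    rewrite -!(sorted_pairwise R_tr) fRs all_c size_map.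
    by case/andP=> ? ? [->].
  left; exists s; move: sort_t sz_t.
  by rewrite def_t def_t1 cats0 size_map fRs; split; rewrite ?all_predT.
case=> [[t [sub_t sz_t sort_t _]] | [t [sub_t sz_t sort_t t_c]]].
  exists (map f t); split; last exact: all_predT.
  - exact: subseq_trans (map_subseq f sub_t) (subseq_rcons _ _).
  - by rewrite size_map.
  - by rewrite sorted_map (eq_sorted (e' := R)).
exists (rcons (map f t) c); split; last exact: all_predT.
- by rewrite -!cats1 cat_subseq ?map_subseq.
- by rewrite size_rcons size_map sz_t.
- rewrite (sorted_pairwise R_tr) pairwise_rcons all_c -(sorted_pairwise R_tr).
  by rewrite t_c sorted_map (eq_sorted (e' := R)).
Qed.

(** * Knuth equivalence *)

Inductive knuth : seq nat -> seq nat -> Prop :=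
| knuth_refl w : knuth w w
| knuth_sym v w of knuth v w : knuth w v
| knuth_trans u v w of knuth u v & knuth v w : knuth u w
| knuth_low u v x y z of x < y & y < z :
    knuth (u ++ [:: y; x; z] ++ v) (u ++ [:: y; z; x] ++ v)
| knuth_high u v x y z of x < y & y < z :
    knuth (u ++ [:: x; z; y] ++ v) (u ++ [:: z; x; y] ++ v).

Lemma knuth_context a b v w : knuth v w -> knuth (a ++ v ++ b) (a ++ w ++ b).
Proof.
elim=> {v w} [w | v w _ IH | u v w _ IH1 _ IH2 | u v x y z xy yz
  | u v x y z xy yz].
- exact: knuth_refl.
- exact: knuth_sym.
- exact: knuth_trans IH1 IH2.
- have := @knuth_low (a ++ u) (v ++ b) _ _ _ xy yz.
  by rewrite -?catA /= -?catA.
- have := @knuth_high (a ++ u) (v ++ b) _ _ _ xy yz.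
  by rewrite -?catA /= -?catA.
Qed.

Lemma knuth_cons a v w : knuth v w -> knuth (a :: v) (a :: w).
Proof. by move/(@knuth_context [:: a] [::]); rewrite !cats0. Qed.

Lemma knuth_perm v w : knuth v w -> perm_eq v w.
Proof.
elim=> {v w} // [v w _ | u v w _ puv _ | u v x y z _ _ | u v x y z _ _].
- by rewrite perm_sym.
- exact: perm_trans.
- rewrite perm_cat2l perm_cat2r; apply/seq.permP=> q /=; lia.
- rewrite perm_cat2l perm_cat2r; apply/seq.permP=> q /=; lia.
Qed.

(** The order R is abstract so that one argument serves both increasing and
    decreasing subsequences: the two kinds of Knuth move are each invariant
    under reversal of the order, up to the direction of the move. *)
Section MonotoneInvariance.

Variables (R : rel nat) (p : pred nat).
Hypotheses (R_tr : transitive R) (R_irr : irreflexive R).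
Hypothesis p_convex : forall x y z, R x y -> R y z -> p x -> p z -> p y.

(** A factor b of a word may be replaced by b' when each monotone subsequence
    t of b can be exchanged for a t' of the same length in b' that fits between
    the same neighbours c. *)
Lemma has_mono_replace b b' :
    (forall t, subseq t b -> pairwise R t -> all p t -> exists t',
      [/\ subseq t' b', size t' = size t, pairwise R t', all p t'
        & forall c, (all (R c) t -> all (R c) t')
                    /\ (all (R^~ c) t -> all (R^~ c) t')]) ->
  forall u v m, has_mono R p m (u ++ b ++ v) -> has_mono R p m (u ++ b' ++ v).
Proof.
move=> rep u v m [t [sub_t sz_t]]; rewrite (sorted_pairwise R_tr).
case/subseq_split: sub_t sz_t => t1 [t0 [-> sub1]].
case/subseq_split=> t2 [t3 [-> sub2 sub3]] sz_t.
rewrite !pairwise_cat !allrel_catr !all_cat -!andbA.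
case/and5P=> r12 r13 pw1 r23 /andP[pw2 pw3] /and3P[p1 p2 p3].
have [t' [sub' sz' pw' p' ext']] := rep _ sub2 pw2 p2.
exists (t1 ++ t' ++ t3); split.
- by rewrite !cat_subseq.
- by rewrite -sz_t !size_cat sz'.
- rewrite (sorted_pairwise R_tr) !pairwise_cat !allrel_catr r13 pw1 pw' pw3.
  rewrite !andbT /=; apply/andP; split; apply/allrelP=> i j t_i t_j.
    have /allP : all (R i) t'; last exact.
    by apply: (ext' i).1; apply/allP=> j' t_j'; apply: (allrelP r12).
  have /allP : all (R^~ j) t'; last exact.
  by apply: (ext' j).2; apply/allP=> i' t_i'; apply: (allrelP r23).
- by rewrite !all_cat p1 p' p3.
Qed.

Lemma R_asym x y : R x y -> R y x = false.
Proof. by move=> xy; apply/negP=> /(R_tr xy); rewrite R_irr. Qed.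

(* Decides, for a concrete list t of variables, whether it is a subsequence of
   the three-letter list b. *)
Local Ltac by_mask b :=
  let go m := exact: (mask_subseq m b) in
  first
  [ go [:: false; false; false] | go [:: true; false; false]
  | go [:: false; true; false] | go [:: false; false; true]
  | go [:: true; true; false] | go [:: true; false; true]
  | go [:: false; true; true] ].

(** In a three-letter window of a Knuth move, the only monotone subsequence
    that the move can destroy is [:: x; z], the pair that it swaps. *)
Lemma monotone_window x y z t : R x y -> R y z -> pairwise R t ->
  [/\ subseq t [:: y; x; z] -> subseq t [:: y; z; x] \/ t = [:: x; z],
      subseq t [:: y; z; x] -> subseq t [:: y; x; z],
      subseq t [:: x; z; y] -> subseq t [:: z; x; y] \/ t = [:: x; z]
    & subseq t [:: z; x; y] -> subseq t [:: x; z; y]].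
Proof.
move=> xy yz; have xz := R_tr xy yz; move=> pw_t.
split=> /subseqP[[|[] [|[] [|[] []]]] // _ def_t]; move: pw_t; rewrite {}def_t.
all: rewrite [mask _ _]/= => pw_t.
all: first [ by right | left; by_mask [:: y; z; x] | left; by_mask [:: z; x; y]
  | by_mask [:: y; x; z] | by_mask [:: x; z; y]
  | by move: pw_t; rewrite /= ?(R_asym xy) ?(R_asym yz) ?(R_asym xz) ?andbF ].
Qed.

Lemma has_mono_low x y z u v m : R x y -> R y z ->
  has_mono R p m (u ++ [:: y; x; z] ++ v) <->
  has_mono R p m (u ++ [:: y; z; x] ++ v).
Proof.
move=> xy yz; split; apply: has_mono_replace => t sub_t pw_t p_t;
  have [win1 win2 _ _] := monotone_window xy yz pw_t; last first.
  by exists t; split=> //; apply: win2.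
have [sub_t' | def_t] := win1 sub_t; first by exists t.
move: p_t; rewrite def_t /= andbT => /andP[px pz].
(* y lies before z in both windows, so it takes over from x. *)
exists [:: y; z]; rewrite /= yz (p_convex xy yz) // pz; split=> //.
  exact: (mask_subseq [:: true; true; false] [:: y; z; x]).
by move=> c; split=> /and3P[cx cz _]; rewrite !andbT ?(R_tr cx xy) ?cz //=;
  rewrite (R_tr yz cz).
Qed.

Lemma has_mono_high x y z u v m : R x y -> R y z ->
  has_mono R p m (u ++ [:: x; z; y] ++ v) <->
  has_mono R p m (u ++ [:: z; x; y] ++ v).
Proof.
move=> xy yz; split; apply: has_mono_replace => t sub_t pw_t p_t;
  have [_ _ win1 win2] := monotone_window xy yz pw_t; last first.
  by exists t; split=> //; apply: win2.
have [sub_t' | def_t] := win1 sub_t; first by exists t.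
move: p_t; rewrite def_t /= andbT => /andP[px pz].
(* y lies after x in both windows, so it takes over from z. *)
exists [:: x; y]; rewrite /= xy (p_convex xy yz) // px; split=> //.
  exact: (mask_subseq [:: false; true; true] [:: z; x; y]).
by move=> c; split=> /and3P[cx cz _]; rewrite !andbT ?(R_tr yz cz) ?cx //=;
  rewrite (R_tr cx xy).
Qed.

End MonotoneInvariance.

Lemma knuth_has_incr (p : pred nat) m v w :
    (forall x y z, x < y < z -> p x -> p z -> p y) ->
  knuth v w -> has_mono ltn p m v <-> has_mono ltn p m w.
Proof.
move=> p_cvx.
have cvx x y z : x < y -> y < z -> p x -> p z -> p y.
  by move=> xy yz; apply: p_cvx; rewrite xy.
elim=> {v w} [w | v w _ [] | u v w _ [IH1 IH2] _ [IH3 IH4] | u v x y z xy yz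
  | u v x y z xy yz] //.
- by split=> [/IH1/IH3 | /IH4/IH2].
- exact: (has_mono_low ltn_trans ltnn cvx).
- exact: (has_mono_high ltn_trans ltnn cvx).
Qed.

Lemma knuth_has_decr (p : pred nat) m v w :
    (forall x y z, x < y < z -> p x -> p z -> p y) ->
  knuth v w -> has_mono gtn p m v <-> has_mono gtn p m w.
Proof.
move=> p_cvx.
have gtnn : irreflexive gtn by move=> x; apply: ltnn.
have cvx x y z : gtn x y -> gtn y z -> p x -> p z -> p y.
  by move=> /= yx zy px pz; apply: p_cvx pz px; rewrite zy.
elim=> {v w} [w | v w _ [] | u v w _ [IH1 IH2] _ [IH3 IH4] | u v x y z xy yz
  | u v x y z xy yz] //.
- by split=> [/IH1/IH3 | /IH4/IH2].
- by apply: iff_sym; apply: (has_mono_low gtn_trans gtnn cvx).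
- by apply: iff_sym; apply: (has_mono_high gtn_trans gtnn cvx).
Qed.

(** * Row insertion *)

(** Rows are read from bottom to top: the order in which the reading word is
    Knuth equivalent to the words that insert to T. *)
Definition reading (T : tableau) : seq nat := flatten (rev T).

Lemma reading_cons r T : reading (r :: T) = reading T ++ r.
Proof. by rewrite /reading rev_cons flatten_rcons. Qed.

(** For increasing rows, the counting condition says that each column increases
    strictly: the j-th entry of the lower row is at most b only if the j-th
    entry of the upper row exists and is smaller than b.  As it involves no
    column index, it is easily followed through a row insertion. *)
Fixpoint is_tableau (T : tableau) : Prop :=
  if T is r :: T' then
    [/\ r != [::], sorted ltn r, is_tableau T'
      & forall b, count (fun y => y <= b) (head [::] T')
                    <= count (fun y => y < b) r]
  else True.

Lemma sorted_ltn_cat r1 y r2 :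
  sorted ltn (r1 ++ y :: r2) =
  [&& sorted ltn r1, sorted ltn r2, all (fun z => z < y) r1
    & all (fun z => y < z) r2].
Proof.
rewrite !(sorted_pairwise ltn_trans) pairwise_cat allrel_consr /=.
case: (boolP (all _ r1)) => [r1y|]; last by rewrite !andbF.
case: (boolP (all _ r2)) => [r2y|]; last by rewrite !andbF.
suff -> : allrel ltn r1 r2 by rewrite /= !andbT.
by apply/allrelP=> a c /(allP r1y) /= ay /(allP r2y) /=; apply: ltn_trans.
Qed.

(** The position computed by [find] becomes a factorization of the row around
    the bumped entry y, which is what concatenation lemmas can use. *)
Variant insertion_spec (T : tableau) (x : nat) :
    seq nat -> tableau * nat -> Prop :=
| InsertAppend r of all (fun z => z < x) r :
    insertion_spec T x r (rcons r x :: T, 0)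
| InsertBump r1 y r2 of all (fun z => z < x) r1 & x < y :
    insertion_spec T x (r1 ++ y :: r2)
      ((r1 ++ x :: r2) :: (row_insert T y).1, (row_insert T y).2.+1).

Lemma row_insertP T x r :
  sorted ltn r -> x \notin r -> insertion_spec T x r (row_insert (r :: T) x).
Proof.
move=> r_sorted xNr /=; set c := find _ r.
have lt_take : all (fun z => z < x) (take c r).
  apply/(all_nthP 0) => i; rewrite size_take_min leq_min => /andP[lt_ic lt_ir].
  rewrite nth_take // ltnNge leq_eqVlt negb_or.
  have /= -> := before_find 0 lt_ic; rewrite andbT.
  by apply: contraNneq xNr => ->; rewrite mem_nth.
case: ltnP => [lt_cr | le_rc]; last first.
  by rewrite take_oversize // in lt_take; constructor.
rewrite -{1}(cat_take_drop c r) (drop_nth 0 lt_cr) set_nthE lt_cr.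
have lt_x : x < nth 0 r c.
  by apply: (nth_find 0 (a := fun y => x < y)); rewrite has_find.
by case: (row_insert _ _) (@InsertBump T x (take c r) _ (drop c.+1 r) lt_take lt_x).
Qed.

Lemma row_insert_shape T x :
  map size (row_insert T x).1 = incr_nth (map size T) (row_insert T x).2.
Proof.
elim: T x => [|r T IH] x //=; case: ifP => [lt_c|_] /=; last first.
  by rewrite size_rcons.
have := IH (nth 0 r (find (fun y => x < y) r)); case: row_insert => T' a /= ->.
by rewrite size_set_nth (maxn_idPr lt_c).
Qed.

Lemma add_cell_shape Q a t :
  map size (add_cell Q a t) = incr_nth (map size Q) a.
Proof.
rewrite /add_cell; elim: Q a => [|r Q IH] [|a] //=; rewrite ?size_rcons ?IH //.
by elim: a => //= a ->.
Qed.

(** Schensted insertion into a row is a sequence of Knuth moves.  First x moves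
    left through r2, each time past a letter that is preceded by a letter
    between x and it, and stops just after y.  Then y moves left through r1,
    each time past a letter b, while the letter that follows y, which is the
    next one of r1 or x, lies between b and y. *)
Lemma knuth_row r1 y r2 x :
    sorted ltn (r1 ++ y :: r2) -> all (fun z => z < x) r1 -> x < y ->
  knuth (r1 ++ y :: rcons r2 x) (y :: r1 ++ x :: r2).
Proof.
rewrite sorted_ltn_cat => /and4P[s1 s2 _ y_r2] r1_x xy.
have right_end : knuth (y :: rcons r2 x) (y :: x :: r2).
  have {s2 y_r2} : path ltn y r2 by rewrite (path_sortedE ltn_trans) y_r2.
  elim: r2 y xy => [|z r2 IH] y xy /=; first by move=> _; apply: knuth_refl.
  case/andP=> yz z_r2; apply: (knuth_trans (knuth_cons _ (IH z _ z_r2))).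
    exact: ltn_trans yz.
  exact: knuth_sym (knuth_low [::] r2 xy yz).
have := knuth_context r1 [::] right_end; rewrite !cats0.
move/knuth_trans; apply.
elim: r1 s1 r1_x => [|b r1 IH] /=; first by move=> _ _; apply: knuth_refl.
rewrite (path_sortedE ltn_trans) => /andP[b_r1 s1] /andP[bx r1_x].
apply: (knuth_trans (knuth_cons b (IH s1 r1_x))).
case: r1 b_r1 r1_x {IH s1} => [|h r1] /=; last first.
  case/andP=> bh _ /andP[hx _].
  exact: (knuth_high [::] (r1 ++ x :: r2) bh (ltn_trans hx xy)).
by move=> _ _; exact: (knuth_high [::] r2 bx xy).
Qed.

Lemma reading_row_insert T x : is_tableau T -> uniq (rcons (reading T) x) ->
  knuth (rcons (reading T) x) (reading (row_insert T x).1).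
Proof.
elim: T x => [|r T IH] x; first by move=> _ _; apply: knuth_refl.
case=> _ r_sorted T_tab _; rewrite reading_cons rcons_uniq mem_cat negb_or cat_uniq.
case/andP=> /andP[xNT xNr] /and3P[uT dis _].
have ins := row_insertP T r_sorted xNr.
case: ins dis r_sorted {xNr} => /= [{}r _|r1 y r2 r1x xy] dis.
  by rewrite reading_cons rcons_cat => _; apply: knuth_refl.
move=> r_sorted; rewrite reading_cons rcons_cat rcons_cat rcons_cons.
have := knuth_context (reading T) [::] (knuth_row r_sorted r1x xy).
rewrite !cats0; move/knuth_trans; apply.
have := @knuth_context [::] (r1 ++ x :: r2) _ _ (IH y T_tab _).
rewrite /= cat_rcons; apply; rewrite rcons_uniq uT andbT.
by move: dis; rewrite has_cat /= !negb_or => /and3P[].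
Qed.

(** When y enters the top row, the number of entries that are at most b grows
    only if y <= b and the bumped entry, if any, exceeds b.  In that case no
    entry lies between y and b, so that before the insertion the entries at
    most b are those at most y.  This is the bound that column strictness above
    the row needs, because y comes from the row above. *)
Lemma count_row_insert T y b : is_tableau T -> y \notin head [::] T ->
  count (fun z => z <= b) (head [::] (row_insert T y).1) <=
  if y <= b then maxn (count (fun z => z <= b) (head [::] T))
                      (count (fun z => z <= y) (head [::] T)).+1
  else count (fun z => z <= b) (head [::] T).
Proof.
case: T => [|s T]; first by move=> _ _ /=; case: (y <= b).
case=> _ s_sorted _ _ yNs; rewrite -[head _ _]/s in yNs *.
have ins := row_insertP T s_sorted yNs.
case: ins s_sorted {yNs} => [{}s s_y|s1 z s2 s1_y yz] /=.
  rewrite -cats1 count_cat /= addn0; case: (leqP y b) => yb _ /=; rewrite ?addn0 //.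
  have -> : count (fun z => z <= y) s = size s.
    by apply/eqP; rewrite -all_count; apply: sub_all s_y => z /ltnW.
  have := count_size (fun z => z <= b) s; lia.
rewrite sorted_ltn_cat => /and4P[_ _ _ z_s2].
have s1_ley : count (fun z => z <= y) s1 = size s1.
  by apply/eqP; rewrite -all_count; apply: sub_all s1_y => t /ltnW.
have := count_size (fun z => z <= b) s1.
rewrite !count_cat /= s1_ley.
have s2_b : b < z -> count (fun z => z <= b) s2 = 0.
  move=> bz; apply/eqP; rewrite eqn0Ngt -has_count -all_predC.
  by apply: sub_all z_s2 => t /= zt; rewrite -ltnNge (ltn_trans bz).
case: (leqP y b) => yb; case: (leqP z b) => zb; lia.
Qed.

Lemma row_insert_tableau T x : is_tableau T -> uniq (rcons (reading T) x) ->
  is_tableau (row_insert T x).1.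
Proof.
elim: T x => [|r T IH] x //.
case=> r_n0 r_sorted T_tab T_r; rewrite reading_cons rcons_uniq mem_cat negb_or cat_uniq.
case/andP=> /andP[xNT xNr] /and3P[uT dis _].
have ins := row_insertP T r_sorted xNr.
case: ins dis r_sorted T_r {r_n0 xNr} => /= [{}r r_x|r1 y r2 r1x xy] dis
  r_sorted T_r.
  split=> //; first by case: (r).
    by rewrite (sorted_pairwise ltn_trans) pairwise_rcons r_x -(sorted_pairwise ltn_trans).
  by move=> b; rewrite -cats1 count_cat (leq_trans (T_r b)) ?leq_addr.
have yNT : y \notin reading T.
  by move: dis; rewrite has_cat /= !negb_or => /and3P[].
move: r_sorted; rewrite sorted_ltn_cat => /and4P[s1 s2 r1y r2y].
split.
- by case: (r1).
- rewrite sorted_ltn_cat s1 s2 r1x /=.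
  by apply: sub_all r2y => z; apply: ltn_trans.
- by apply: IH; rewrite // rcons_uniq yNT.
have yNh : y \notin head [::] T.
  apply: contra yNT; case: (T) => // s T' /=.
  by rewrite reading_cons mem_cat => ->; rewrite orbT.
move=> b; apply: leq_trans (count_row_insert b T_tab yNh) _.
have := T_r b; have := T_r y; rewrite !count_cat /= ltnn.
have r1_y : count (fun z => z < y) r1 = size r1.
  by apply/eqP; rewrite -all_count.
have r2_y : count (fun z => z < y) r2 = 0.
  apply/eqP; rewrite eqn0Ngt -has_count -all_predC.
  by apply: sub_all r2y => t /= /ltnW; rewrite -leqNgt.
have r1_b : x < b -> count (fun z => z < b) r1 = size r1.
  by move=> xb; apply/eqP; rewrite -all_count; apply: sub_all r1x => t /ltn_trans; apply.
rewrite r1_y r2_y.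
by case: (leqP y b) => yb; case: (ltnP x b) => [/[dup] xb /r1_b-> | xb]; lia.
Qed.

(** The induction runs over the part v still to be inserted, the current
    tableau T being Knuth equivalent to the part u already inserted. *)
Lemma RSK_correct n (s : 'S_n) P Q : uniq (one_line s) -> RSK s = (P, Q) ->
  [/\ is_tableau P, knuth (one_line s) (reading P) & map size Q = map size P].
Proof.
rewrite /RSK; set w := one_line s.
have : size (iota 1 n) = size w by rewrite size_iota /w size_map size_enum_ord.
suff gen T U u ts v : size ts = size v -> uniq (u ++ v) ->
    is_tableau T -> knuth u (reading T) -> map size U = map size T ->
    foldl RSK_step (T, U) (zip ts v) = (P, Q) ->
  [/\ is_tableau P, knuth (u ++ v) (reading P) & map size Q = map size P].
  by move=> sz uw; apply: (gen [::] [::] [::]) => //; apply: knuth_refl.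
elim: v ts T U u => [|x v IH] [|t ts] T U u //= => [_ _ T_tab uT sTU [<- <-]|[sz]].
  by rewrite cats0.
rewrite -cat_rcons => u_uv T_tab uT sTU.
have ux_Tx : knuth (rcons u x) (rcons (reading T) x).
  by have := knuth_context [::] [:: x] uT; rewrite !cats1.
have u_Tx : uniq (rcons (reading T) x).
  by rewrite -(perm_uniq (knuth_perm ux_Tx)); move: u_uv; rewrite cat_uniq => /andP[].
have := row_insert_shape T x; have := row_insert_tableau T_tab u_Tx.
have := reading_row_insert T_tab u_Tx.
case: row_insert => T' a /= Tx_T' T'_tab sT'; apply: IH => //.
  exact: knuth_trans ux_Tx Tx_T'.
by rewrite add_cell_shape sTU sT'.
Qed.

(** * Monotone subsequences of the reading word of a tableau *)

(** Induction on the rows: if h is the first letter that the subsequence takes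
    in the top row, the letters before h are below h, so by induction and
    column strictness there are no more of them than entries of the top row
    below h; the others are entries of the top row between h and b. *)
Lemma incr_reading T b m : is_tableau T ->
  has_mono ltn (fun x => x < b) m (reading T) <->
  m <= count (fun x => x < b) (head [::] T).
Proof.
move=> T_tab; split=> [[t [sub_t <- sort_t t_b]]|]; last first.
  move=> le_m; apply: (has_mono_le le_m).
  exists (filter (fun x => x < b) (head [::] T)); split.
  - apply: subseq_trans (filter_subseq _ _) _.
    by case: T {T_tab le_m} => // r T; rewrite reading_cons suffix_subseq.
  - exact: size_filter.
  - by apply: (sorted_filter ltn_trans); case: T T_tab {le_m} => // r T [].
  - exact: filter_all.
elim: T T_tab b t sub_t sort_t t_b => [|r T IH] /=; first by move=> _ b t /eqP->.
case=> _ r_sorted T_tab T_r b t; rewrite reading_cons.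
case/subseq_split=> t1 [t2 [-> sub1 sub2]]; rewrite all_cat => sort_t /andP[t1_b t2_b].
have T_r' c : count (fun x => x < c) (head [::] T) <= count (fun x => x < c) r.
  by apply: leq_trans (T_r c); apply: sub_count => x /ltnW.
case: t2 sub2 sort_t t2_b => [|h t2] sub2.
  by rewrite cats0 => sort_t _; apply: leq_trans (T_r' b); apply: IH.
rewrite sorted_ltn_cat => /and4P[sort1 sort2 t1_h h_t2] ht2_b.
have le1 := leq_trans (IH T_tab h t1 sub1 sort1 t1_h) (T_r' h).
have le2 : size (h :: t2) <= count (fun x => h <= x < b) r.
  apply: leq_trans (leq_count_subseq _ sub2).
  rewrite leq_eqVlt eq_sym -all_count; apply/orP; left.
  move: ht2_b => /= /andP[-> t2_b]; rewrite leqnn /=.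
  by apply/allP=> x t2x; rewrite (allP t2_b) // ltnW // (allP h_t2).
have hb : h < b by case/andP: ht2_b.
rewrite size_cat (leq_trans (leq_add le1 le2)) // -count_predUI.
rewrite [X in _ + X](_ : _ = 0) ?addn0.
  by apply: sub_count => x /= /orP[/ltn_trans -> // | /andP[]].
apply/eqP; rewrite eqn0Ngt -has_count -all_predC; apply/allP=> x _ /=.
by case: ltnP.
Qed.

Definition transversal (t : seq nat) (T : tableau) :=
  all2 (fun x (r : seq nat) => x \in r) t T.

Lemma transversalP t T :
  reflect (size t = size T /\
           forall i, i < size T -> nth 0 t i \in nth [::] T i)
          (transversal t T).
Proof.
rewrite /transversal all2E; apply: (iffP andP) => [[/eqP sz tT] | [sz tT]].
  split=> // i lt_i; move/(all_nthP (0, [::])): tT => /(_ i).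
  by rewrite size_zip sz minnn nth_zip //; apply.
split; first exact/eqP.
apply/(all_nthP (0, [::])) => i; rewrite size_zip sz minnn => lt_i.
by rewrite nth_zip //; apply: tT.
Qed.

Lemma rev_sorted_gtn t : sorted gtn (rev t) = sorted ltn t.
Proof. by rewrite rev_sorted. Qed.

Lemma decr_row_size r t : sorted ltn r -> subseq t r -> sorted gtn t -> size t <= 1.
Proof.
move=> r_sorted sub_t; have := subseq_sorted ltn_trans sub_t r_sorted.
case: t {sub_t} => [|x [|y t]] //= /andP[xy _] /andP[yx _].
by have := ltn_trans xy yx; rewrite ltnn.
Qed.

Lemma decr_reading_size T t : is_tableau T ->
  subseq t (reading T) -> sorted gtn t -> size t <= size T.
Proof.
elim: T t => [|r T IH] t; first by move=> _ /eqP->.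
case=> _ r_sorted T_tab _; rewrite reading_cons.
case/subseq_split=> t1 [t2 [-> sub1 sub2]] sort_t.
have [sort1 sort2] := cat_sorted2 sort_t.
rewrite size_cat /= -addn1 leq_add ?IH //.
exact: decr_row_size sub2 sort2.
Qed.

Lemma transversal_subseq t T : transversal t T -> subseq (rev t) (reading T).
Proof.
elim: T t => [|r T IH] [|x t] //= /andP[xr tT].
by rewrite reading_cons rev_cons -cats1 cat_subseq ?IH ?sub1seq.
Qed.

(** A decreasing subsequence takes at most one entry from each increasing row,
    so when its length is the number of rows it takes exactly one. *)
Lemma decr_reading_transversal T t : is_tableau T ->
    subseq (rev t) (reading T) -> sorted ltn t -> size t = size T ->
  transversal t T.
Proof.
elim: T t => [|r T IH] t; first by case: t.
move=> rT_tab sub_t sort_t sz_t; have [_ r_sorted T_tab _] := rT_tab.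
case: t sub_t sort_t sz_t => // x t; rewrite rev_cons reading_cons.
move=> sub_t sort_t [sz_t].
have sort_rt : sorted gtn (rcons (rev t) x) by rewrite -rev_cons rev_sorted_gtn.
case/subseq_split: sub_t => t1 [t2 [def_t sub1 sub2]].
have [sort1 sort2] : sorted gtn t1 /\ sorted gtn t2.
  by move: sort_rt; rewrite def_t => /cat_sorted2[].
have le1 := decr_reading_size T_tab sub1 sort1.
have le2 := decr_row_size r_sorted sub2 sort2.
have sz_t12 : (size T).+1 = size t1 + size t2.
  by rewrite -size_cat -def_t size_rcons size_rev sz_t.
case: t2 def_t sub2 sort2 le2 sz_t12 => [|y [|? ?]] //=.
  by move=> _ _ _ _; rewrite addn0 => sz; rewrite -sz ltnn in le1.
rewrite cats1 sub1seq => /rcons_inj[t1_rev <-] xr _ _ _.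
rewrite /transversal /= xr /=; apply: IH => //; first by rewrite t1_rev.
exact: path_sorted sort_t.
Qed.

(** Built upwards from any entry of the last row: column strictness provides a
    smaller entry in the row above. *)
Lemma tableau_transversal T :
  is_tableau T -> exists2 t, sorted ltn t & transversal t T.
Proof.
elim: T => [|r T IH]; first by exists [::].
case=> r_n0 _ /IH[t sort_t tT] T_r.
case: T tT T_r {IH} => [|s T] tT T_r.
  by case: r r_n0 {T_r} => // x r _; exists [:: x]; rewrite /transversal //= mem_head.
case: t tT sort_t => //= e t /andP[es tT] sort_t.
have : 0 < count (fun y => y < e) r.
  by apply: leq_trans (T_r e); rewrite -has_count; apply/hasP; exists e.
rewrite -has_count => /hasP[x xr xe].
by exists [:: x, e & t]; rewrite /transversal /= ?xe // xr es.
Qed.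

Lemma decr_reading T p : is_tableau T ->
  has_mono gtn p (size T) (reading T) <->
  exists t, [/\ sorted ltn t, transversal t T & all p t].
Proof.
move=> T_tab; split=> [[t [sub_t sz_t sort_t p_t]] | [t [sort_t tT p_t]]].
  have sort_rt : sorted ltn (rev t) by rewrite -rev_sorted_gtn revK.
  exists (rev t); split; rewrite ?all_rev //.
  by apply: decr_reading_transversal; rewrite ?revK ?size_rev.
exists (rev t); split; rewrite ?all_rev ?rev_sorted_gtn //.
  exact: transversal_subseq.
by rewrite size_rev; case/transversalP: tT.
Qed.

Lemma longest_decr_reading T m : is_tableau T ->
  has_mono gtn predT m (reading T) <-> m <= size T.
Proof.
move=> T_tab; split=> [[t [sub_t <- sort_t _]] | le_m].
  exact: decr_reading_size.
apply: (has_mono_le le_m); apply/decr_reading=> //.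
by have [t sort_t tT] := tableau_transversal T_tab; exists t; rewrite all_predT.
Qed.

Lemma all_lt_last r c : sorted ltn r -> r != [::] ->
  all (fun x => x < c) r = (last 0 r < c).
Proof.
case/lastP: r => // r x; rewrite (sorted_pairwise ltn_trans) pairwise_rcons.
case/andP=> r_x _ _; rewrite all_rcons last_rcons; case: ltnP => //= xc.
by apply: sub_all r_x => y /ltn_trans; apply.
Qed.

(** The lower bound by the last entry of the top row pins down where a
    transversal starts: no other entry of that row satisfies it. *)
Lemma has_chainE T : is_tableau T -> T != [::] ->
  has_chain_from T (size T) (size (head [::] T)) <->
  has_mono gtn (fun x => last 0 (head [::] T) <= x) (size T) (reading T).
Proof.
move=> T_tab T_n0; have T_gt0 : 0 < size T by rewrite lt0n size_eq0.
set r := head [::] T; set a := last 0 r.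
have r_first : nth [::] T 0 = r by rewrite nth0.
have [r_n0 r_sorted] : r != [::] /\ sorted ltn r.
  by rewrite /r; case: (T) T_tab T_n0 => // ? ? [].
have r_gt0 : 0 < size r by rewrite lt0n size_eq0.
apply: iff_trans (iff_sym (decr_reading _ T_tab)); split.
  case=> j [j1 j_cell j_incr].
  set t := [seq entry T i (j i) | i <- iota 1 (size T)].
  have sz_t : size t = size T by rewrite size_map size_iota.
  have nth_t i : i < size T -> nth 0 t i = entry T i.+1 (j i.+1).
    by move=> lt_i; rewrite (nth_map 0) ?size_iota // nth_iota.
  have sort_t : sorted ltn t.
    apply/(sortedP 0) => i; rewrite sz_t => lt_i.
    by rewrite !nth_t ?(ltnW lt_i) //; apply: j_incr; rewrite ltn0Sn.
  exists t; split=> //.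
    apply/transversalP; split=> // i lt_i; rewrite nth_t //.
    have /andP[_ /andP[]] := j_cell i.+1 lt_i; rewrite /entry /=.
    by case: (j i.+1) => // c _ lt_c; rewrite mem_nth.
  have t0 : nth 0 t 0 = a.
    by rewrite nth_t // /entry j1 /= r_first nth_last.
  case: t sort_t t0 sz_t {nth_t} => [|x t] /= x_t x_a; first by lia.
  move=> _; rewrite x_a leqnn /=; rewrite x_a in x_t.
  by apply: sub_all (order_path_min ltn_trans x_t) => y /ltnW.
case=> t [sort_t /transversalP[sz_t tT] t_a].
exists (fun i => (index (nth 0 t i.-1) (nth [::] T i.-1)).+1).
have entry_t i : i < size T ->
    entry T i.+1 (index (nth 0 t i) (nth [::] T i)).+1 = nth 0 t i.
  by move=> lt_i; rewrite /entry /= nth_index ?tT.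
split.
- have t0r := tT 0 T_gt0; rewrite /= r_first in t0r *.
  have a_t0 : a <= nth 0 t 0 by apply: (allP t_a); rewrite mem_nth ?sz_t.
  have lt_c : index (nth 0 t 0) r < size r by rewrite index_mem.
  apply/eqP; rewrite eqn_leq lt_c /= leqNgt; apply/negP=> lt_c1.
  have lt_c2 : index (nth 0 t 0) r < (size r).-1 by rewrite -ltnS prednK.
  have := sorted_ltn_nth ltn_trans 0 r_sorted _ _ lt_c _ lt_c2.
  by rewrite inE ltn_predL r_gt0 nth_index // nth_last ltnNge a_t0 => /(_ isT).
- case=> // i /= lt_i; rewrite /is_cell /= lt_i /=.
  by rewrite index_mem; apply: tT.
- case=> // i /= lt_i; rewrite !entry_t ?(ltnW lt_i) //.
  by apply: (sorted_ltn_nth ltn_trans 0 sort_t); rewrite ?inE ?sz_t ?(ltnW lt_i).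
Qed.

(** * Extensions to the right *)

Lemma one_line_uniq n (s : 'S_n) : uniq (one_line s).
Proof. by rewrite map_inj_uniq ?enum_uniq // => i j [] /val_inj /perm_inj. Qed.

Lemma one_line_bounds n (s : 'S_n) x : x \in one_line s -> 0 < x <= n.
Proof. by case/mapP=> i _ ->; rewrite /= ltn_ord. Qed.

Lemma size_one_line n (s : 'S_n) : size (one_line s) = n.
Proof. by rewrite size_map size_enum_ord. Qed.

Lemma contains_incrE m n (s : 'S_n) :
  contains_incr m s <-> has_mono ltn predT m (one_line s).
Proof. by split=> [[t []]|[t []]]; exists t; split=> //; apply: all_predT. Qed.

Lemma contains_decrE m n (s : 'S_n) :
  contains_decr m s <-> has_mono gtn predT m (one_line s).
Proof. by split=> [[t []]|[t []]]; exists t; split=> //; apply: all_predT. Qed.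

Lemma shift_from_mono c x y : (shift_from c x < shift_from c y) = (x < y).
Proof. by rewrite /shift_from; case: (ltnP x c); case: (ltnP y c); lia. Qed.

Lemma contains_incr_extension n (s : 'S_n) (i : 'I_n.+1) k :
  contains_incr k.+1 (right_extension s i) <->
  contains_incr k.+1 s \/ has_mono ltn (fun x => x < i.+1) k (one_line s).
Proof.
rewrite !contains_incrE one_line_extension.
apply: has_mono_rcons => [|x y|x]; first exact: ltn_trans.
  exact: shift_from_mono.
by rewrite /= /shift_from; case: (ltnP x i.+1); lia.
Qed.

Lemma contains_decr_extension n (s : 'S_n) (i : 'I_n.+1) l :
  contains_decr l.+1 (right_extension s i) <->
  contains_decr l.+1 s \/ has_mono gtn (fun x => i.+1 <= x) l (one_line s).
Proof.
rewrite !contains_decrE one_line_extension.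
apply: has_mono_rcons => [|x y|x]; first exact: gtn_trans.
  exact: shift_from_mono.
by rewrite /= /shift_from; case: (ltnP x i.+1); lia.
Qed.

Lemma right_crucialE k l n (s : 'S_n) :
  right_crucial k.+1 l.+1 s <->
  [/\ ~ has_mono ltn predT k.+1 (one_line s),
      ~ has_mono gtn predT l.+1 (one_line s)
    & forall c, c <= n -> has_mono ltn (fun x => x < c.+1) k (one_line s) \/
                          has_mono gtn (fun x => c.+1 <= x) l (one_line s)].
Proof.
split=> -[no_incr no_decr ext]; split.
- by move/contains_incrE.
- by move/contains_decrE.
- move=> c le_cn; case: (ext (Ordinal (le_cn : c < n.+1))).
    by case/contains_incr_extension=> [/no_incr //|]; left.
  by case/contains_decr_extension=> [/no_decr //|]; right.
- by move/contains_incrE.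
- by move/contains_decrE.
- move=> i; case: (ext i (leq_ord i)) => [incr | decr]; [left | right].
    by apply/contains_incr_extension; right.
  by apply/contains_decr_extension; right.
Qed.

Theorem theorem12 (k l n : nat) (k_gt0 : 0 < k) (l_gt0 : 0 < l) (n_gt0 : 0 < n)
    (sigma : 'S_n) (P Q : tableau) (RSK_sigma : RSK sigma = (P, Q)) :
  right_crucial k l sigma <->
  [/\ nb_cols P = k - 1 /\ nb_cols Q = k - 1,
      nb_rows P = l - 1 /\ nb_rows Q = l - 1
    & has_chain_from P (l - 1) (k - 1)].
Proof.
case: k l k_gt0 l_gt0 => [|k] [|l] // _ _; rewrite !subn1 /=.
have [P_tab w_P shapeQP] := RSK_correct (one_line_uniq sigma) RSK_sigma.
have -> : nb_rows Q = nb_rows P by rewrite /nb_rows -!(size_map size) shapeQP.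
have -> : nb_cols Q = nb_cols P.
  by move: shapeQP; rewrite /nb_cols; case: (Q) (P) => [|? ?] [|? ?] //= [].
have incr_below m b : has_mono ltn (fun x => x < b) m (one_line sigma) <->
    m <= count (fun x => x < b) (head [::] P).
  apply: iff_trans (incr_reading _ _ P_tab); apply: knuth_has_incr => // x y z.
  by case/andP=> xy yz _; apply: ltn_trans.
have decr_above m b : has_mono gtn (fun x => b <= x) m (one_line sigma) <->
    has_mono gtn (fun x => b <= x) m (reading P).
  apply: knuth_has_decr => // x y z /andP[xy _] bx _.
  exact: leq_trans bx (ltnW xy).
have decr_any m : has_mono gtn predT m (one_line sigma) <-> m <= size P.
  by apply: iff_trans (longest_decr_reading _ P_tab); apply: knuth_has_decr.
have P_bounds x : x \in reading P -> 0 < x <= n.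
  by rewrite -(perm_mem (knuth_perm w_P)); apply: one_line_bounds.
have head_bounds x : x \in head [::] P -> 0 < x <= n.
  move=> x_r; apply: P_bounds; case: (P) x_r => // r T.
  by rewrite reading_cons mem_cat => ->; rewrite orbT.
have incr_any m : has_mono ltn predT m (one_line sigma) <-> m <= nb_cols P.
  have -> : nb_cols P = count (fun x => x < n.+1) (head [::] P).
    by apply/esym/eqP; rewrite -all_count; apply/allP=> x /head_bounds /andP[].
  apply: iff_trans (incr_below m n.+1); split; last exact: sub_has_mono.
  case=> t [sub_t sz_t sort_t _]; exists t; split=> //.
  by apply/allP=> x /(mem_subseq sub_t) /one_line_bounds /andP[].
have P_n0 : P != [::].
  apply: contraTneq n_gt0 => P0; rewrite -(size_one_line sigma).
  by rewrite (perm_size (knuth_perm w_P)) P0.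
have cols_gt0 : 0 < nb_cols P.
  by move: P_tab P_n0; rewrite /nb_cols; case: (P) => // -[|? ?] ? [].
have rows_gt0 : 0 < nb_rows P by rewrite lt0n size_eq0.
set r := head [::] P; pose a := last 0 r.
have below_all c : nb_cols P <= count (fun x => x < c) r <-> a < c.
  have [r_n0 r_sorted] : r != [::] /\ sorted ltn r.
    by rewrite /r; case: (P) P_tab P_n0 => // ? ? [].
  rewrite -all_lt_last // all_count eqn_leq count_size; split=> //.
have chainE : has_chain_from P (nb_rows P) (nb_cols P) <->
    has_mono gtn (fun x => a <= x) (nb_rows P) (one_line sigma).
  by apply: iff_trans (has_chainE P_tab P_n0) _; apply: iff_sym.
apply: (iff_trans (right_crucialE _ _ _)); split=> [[no_incr no_decr ext] | ].
  have le_rows : nb_rows P <= l by rewrite leqNgt; apply/negP=> /decr_any.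
  have le_cols : nb_cols P <= k by rewrite leqNgt; apply/negP=> /incr_any.
  (* No value is below 1, so the extension by 1 must create a longer decreasing
     subsequence. *)
  have rowsE : nb_rows P = l.
    apply/eqP; rewrite eqn_leq le_rows /=; case: (ext 0 isT).
      move/incr_below; rewrite (eq_in_count (a2 := pred0)) ?count_pred0; first by lia.
      by move=> x /head_bounds /=; lia.
    by move=> decr; apply/decr_any; apply: sub_has_mono decr.
  (* No value is above n, so the extension by n+1 must create a longer
     increasing subsequence. *)
  have colsE : nb_cols P = k.
    apply/eqP; rewrite eqn_leq le_cols /=; case: (ext n (leqnn n)).
      by move=> incr; apply/incr_any; apply: sub_has_mono incr.
    case=> -[|x t] [sub_t sz_t _ t_n]; first by move: rows_gt0; rewrite rowsE -sz_t.
    have := one_line_bounds (mem_subseq sub_t (mem_head x t)).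
    by case/andP: t_n; lia.
  split=> //; rewrite -rowsE -colsE; apply/chainE.
  have /andP[a_gt0 a_n] : 0 < a <= n.
    by apply: head_bounds; rewrite /a -nth_last mem_nth // ltn_predL.
  (* Ordinal values are 0-based: the extension by the letter a has index a-1. *)
  case: (ext a.-1); rewrite ?prednK //; first by lia.
    by rewrite -colsE => /incr_below /below_all; rewrite ltnn.
  by rewrite -rowsE.
case=> [[colsE _] [rowsE _]]; rewrite -colsE -rowsE => /chainE chain; split.
- by move/incr_any; rewrite ltnn.
- by move/decr_any; rewrite ltnn.
- move=> c le_cn; case: (ltnP a c.+1) => [lt_ac | le_ca].
    by left; apply/incr_below/below_all.
  by right; apply: sub_has_mono chain => x; apply: leq_trans.
Qed.
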